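(* Let $p\ge1$ and $\ell\ge1$ be integers. The number $s_\ell(I_p)$ of Markov equivalence classes of size $\ell$ with skeleton the path $I_p$ equals the total number of compositions $c_1+\cdots+c_{k+1}=p-k$ of $p-k$ into $k+1$ parts satisfying $$\ell=\prod_{i=1}^{k+1}c_i,$$ as $k$ varies over $0,1,\ldots,\left\lfloor\frac p2\right\rfloor$.
   Context: A DAG with skeleton $G$ (a finite simple undirected graph) is an acyclic orientation of all edges of $G$. An immorality in a DAG is an induced subgraph $i\to j\leftarrow k$ (so $i,k$ are nonadjacent). Two DAGs are Markov equivalent iff they have the same skeleton and the same set of immoralities; a Markov equivalence class (MEC) with skeleton $G$ is an equivalence class of DAGs with skeleton $G$, and its size is the number of DAGs in it. $s_\ell(G)$ is the number of MECs with skeleton $G$ of size $\ell$. $I_p$ is the path with $p$ vertices. A composition of $n$ into $r$ parts is an ordered $r$-tuple of positive integers summing to $n$. *)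

(* Defs.v *)
From mathcomp Require Import all_boot.

Set Implicit Arguments.
Unset Strict Implicit.
Unset Printing Implicit Defensive.

Record sgraph := SGraph {
  vertex :> finType;
  edge : rel vertex;
  edge_sym : symmetric edge;
  edge_irrefl : irreflexive edge
}.

Section Digraph.

Variable T : finType.

(* A digraph on T is given by its set of arcs; (x, y) \in D stands for
   x -> y. *)
Definition arc (D : {set T * T}) : rel T := fun x y => (x, y) \in D.

Definition adj (D : {set T * T}) : rel T := fun x y => arc D x y || arc D y x.

(* Decidable form of "there is no directed cycle", see acyclicP. *)
Definition acyclic (D : {set T * T}) : bool :=
  [forall x, forall y, arc D x y ==> ~~ connect (arc D) y x].

Lemma acyclicP (D : {set T * T}) :
  reflect (forall s : seq T, cycle (arc D) s -> s = [::]) (acyclic D).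
Proof.
apply: (iffP idP) => [acD [//|x s] | noc].
  rewrite /= rcons_path => /andP[xs lx].
  move/forallP: acD => /(_ (last x s)) /forallP/(_ x) /implyP/(_ lx) /negP[].
  by apply/connectP; exists s.
apply/forallP => x; apply/forallP => y; apply/implyP => xy; apply/negP.
case/connectP=> s ys xl.
by have := noc (y :: s); rewrite /= rcons_path ys -xl xy => /(_ isT).
Qed.

Definition same_skeleton (D1 D2 : {set T * T}) : bool :=
  [forall x, forall y, adj D1 x y == adj D2 x y].

(* The immorality i -> j <- k is recorded as the triple (i, j, k); the mirror
   triple (k, j, i) is then recorded too. *)
Definition immoralities (D : {set T * T}) : {set T * T * T} :=
  [set t : T * T * T | let: (i, j, k) := t in
    [&& i != k, arc D i j, arc D k j & ~~ adj D i k]].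

Definition markov_equiv (D1 D2 : {set T * T}) : bool :=
  same_skeleton D1 D2 && (immoralities D1 == immoralities D2).

Lemma markov_equiv_equivalence : equivalence_rel markov_equiv.
Proof.
move=> D1 D2 D3; split.
  by rewrite /markov_equiv eqxx andbT; do 2!apply/forallP => ?.
case/andP=> /forallP sk /eqP im; rewrite /markov_equiv im; congr (_ && _).
apply: eq_forallb => x; apply: eq_forallb => y.
by rewrite (eqP (forallP (sk x) y)).
Qed.

End Digraph.

Definition is_orientation (G : sgraph) (D : {set G * G}) : bool :=
  [forall x, forall y,
    (edge x y == adj D x y) && ~~ (arc D x y && arc D y x)].

Definition dags (G : sgraph) : {set {set G * G}} :=
  [set D | is_orientation D && acyclic D].

Definition MECs (G : sgraph) : {set {set {set G * G}}} :=
  equivalence_partition (@markov_equiv G) (dags G).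

Definition num_MECs (l : nat) (G : sgraph) : nat :=
  #|[set C in MECs G | #|C| == l]|.

Definition path_edge (p : nat) : rel 'I_p :=
  fun i j => (i.+1 == j :> nat) || (j.+1 == i :> nat).

Lemma path_edge_sym p : symmetric (@path_edge p).
Proof. by move=> i j; rewrite /path_edge orbC. Qed.

Lemma path_edge_irrefl p : irreflexive (@path_edge p).
Proof. by move=> i; rewrite /path_edge orbb -[i.+1]addn1 -{2}[val i]addn0 eqn_add2l. Qed.

Definition path_graph (p : nat) : sgraph :=
  SGraph (@path_edge_sym p) (@path_edge_irrefl p).

(* Every part of a composition of n is at most n, so parts range over
   'I_n.+1 to make the type finite. *)
Definition compositions (n r : nat) : {set r.-tuple 'I_n.+1} :=
  [set c : r.-tuple 'I_n.+1 |
    [forall i : 'I_r, 0 < tnth c i] && (\sum_(i < r) tnth c i == n)].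

(* Main.v *)
Require Import Defs.
From mathcomp Require Import all_boot zify.
(* [arc] stands for the digraph relation rather than for [path.arc]. *)
Import Defs.

(** An orientation of the path on [n.+1] vertices is a word of [n] bits, the bit
    at [i] saying whether the edge between [i] and [i.+1] points to the right.
    Every such orientation is acyclic, and its immoralities are the occurrences
    of the factor [10] (right, then left), because the two outer vertices of
    three consecutive ones are never adjacent.  Occurrences of [10] do not
    overlap, so a word with [k] of them reads
      [B_0 10 B_1 10 ... 10 B_k]
    where no block contains [10], that is, [B_i = 0^a 1^b].  Conversely,
    inserting [10] between such blocks creates no other occurrence, since it
    begins with [1] and ends with [0].  Hence the Markov equivalence classes
    correspond to the lists of block lengths, and each block of length [g] can be
    filled in [g.+1] ways.

    With [c_i] the length of the [i]-th block plus one, the class has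
    [\prod_i c_i] elements, and [\sum_i c_i = (n - 2 * k) + (k + 1) = p - k] for
    [p = n.+1].  The list [parts u] computes these [c_i].  The argument
    rests on [markov_equiv_orient] (equivalence of orientations is equality of
    [parts]), [mem_fillings] and [size_fillings] (the fibres of [parts] and
    their size) and [mem_part_seqs] (the image of [parts]).  In terms of [c]
    alone the sum condition reads [sumn c + size c = p.+1], so [k] is recovered
    from [c] as [(size c).-1], and the classes can be sorted by [k]. *)

(** * Block decomposition of bit words *)

(** Block lengths plus one.  Any bit that does not start a factor [10] lies in
    the first block, hence the increment of the head entry. *)
Fixpoint parts (u : seq bool) : seq nat :=
  match u with
  | true :: (false :: u') => 1 :: parts u'
  | _ :: u' => incr_nth (parts u') 0
  | [::] => [:: 1]
  end.

(** The default [true] means that a final [1] starts no factor [10]. *)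
Fixpoint colliders (u : seq bool) : seq bool :=
  if u is b :: u' then (b && ~~ head true u') :: colliders u' else [::].

(** The words with blocks of lengths [g.-1] for [g] in [c]: each block is
    [0^a 1^b] with [a + b = g.-1], hence one choice of [a < g] per block. *)
Fixpoint fillings (c : seq nat) : seq (seq bool) :=
  match c with
  | [::] => [::]
  | [:: g] => [seq nseq a false ++ nseq (g.-1 - a) true | a <- iota 0 g]
  | g :: c' => [seq nseq a false ++ nseq (g.-1 - a) true ++ [:: true, false & t]
               | a <- iota 0 g, t <- fillings c']
  end.

(** Induction following the recursion of [parts]: peel off a factor [10], or a
    bit that does not start one. *)
Lemma parts_ind (P : seq bool -> Prop) :
  P [::] -> (forall u, P u -> P [:: true, false & u]) ->
  (forall b u, ~~ (b && ~~ head true u) -> P u -> P (b :: u)) ->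
  forall u, P u.
Proof.
move=> P0 P10 P1 u; have [m] := ubnP (size u).
elim: m u => // m IH [//|b u] /= le_u.
case E: (b && ~~ head true u); last by apply: P1; rewrite ?E //; apply: IH.
case: b u E le_u => [] [|[] u] //= _ le_u.
by apply/P10/IH; lia.
Qed.

Lemma parts_cons b u :
  ~~ (b && ~~ head true u) -> parts (b :: u) = incr_nth (parts u) 0.
Proof. by case: b u => [] [|[] u]. Qed.

Lemma parts_neq0 u : parts u != [::].
Proof.
by elim/parts_ind: u => // b u nc; rewrite parts_cons //; case: (parts u).
Qed.

Lemma parts_gt0 u : all (leq 1) (parts u).
Proof.
elim/parts_ind: u => // b u nc; rewrite parts_cons //.
by case: (parts u) => //= g c /andP[].
Qed.

(** With [k.+1] blocks, the [k] factors [10] take [2 * k] bits and each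
    block one bit less than its part: [size u = sumn c - k.+1 + 2 * k]. *)
Lemma sumn_parts u : sumn (parts u) + size (parts u) = (size u).+2.
Proof.
elim/parts_ind: u => //= [u IH|b u nc]; first by lia.
by rewrite -/(parts (b :: u)) parts_cons //; case: (parts u) => //= g c; lia.
Qed.

Lemma size_colliders u : size (colliders u) = size u.
Proof. by elim: u => //= b u ->. Qed.

Lemma nth_colliders u i :
  nth false (colliders u) i = nth false u i && ~~ nth true u i.+1.
Proof. by elim: u i => [|b u IH] [|i] //=; rewrite ?nth0 ?IH. Qed.

(** The block lengths determine where the factors [10] start; this makes
    [colliders u] a function of [parts u]. *)
Fixpoint colliders_of_parts (c : seq nat) : seq bool :=
  match c with
  | [::] => [::]
  | [:: g] => nseq g.-1 false
  | g :: c' => nseq g.-1 false ++ [:: true, false & colliders_of_parts c']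
  end.

Lemma colliders_of_partsK u : colliders_of_parts (parts u) = colliders u.
Proof.
elim/parts_ind: u => [//|u /= <-|b u nc IH].
  by case: (parts u) (parts_neq0 u).
rewrite parts_cons //= (negbTE nc) -IH.
by case: (parts u) (parts_neq0 u) (parts_gt0 u) => [//|[|g] [|h c]].
Qed.

(** Conversely, reading two words in parallel, [parts] branches only on whether
    a factor [10] starts at the current bit. *)
Lemma colliders_parts u v : (colliders u == colliders v) = (parts u == parts v).
Proof.
apply/eqP/eqP => [|eq_p]; last by rewrite -!colliders_of_partsK eq_p.
elim/parts_ind: u v => [[]//|u IH|b u nc IH].
  by case=> [|[] [|[] v]] //= [] /IH ->.
case=> [//|b' v] [] eq_b /IH eq_p.
by rewrite !parts_cons ?eq_p // -eq_b.
Qed.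

Lemma parts_block a b : parts (nseq a false ++ nseq b true) = [:: (a + b).+1].
Proof.
elim: a => [|a /= -> //]; elim: b => //= b; rewrite !add0n /= => IH.
by case: b IH => [//|b] /= ->.
Qed.

Lemma parts_block_cat a b t :
  parts (nseq a false ++ nseq b true ++ [:: true, false & t]) =
  (a + b).+1 :: parts t.
Proof.
elim: a => [|a /= -> //]; elim: b => //= b; rewrite !add0n /= => IH.
by case: b IH => [//|b] /= ->.
Qed.

Lemma parts_fillings c u : u \in fillings c -> parts u = c.
Proof.
elim: c u => [//|g [|h c] IH] u.
  case/mapP=> a; rewrite mem_iota => a_g ->.
  by rewrite parts_block; congr (_ :: _); lia.
case/allpairsPdep=> a [t] []; rewrite mem_iota => a_g /IH <- ->.
by rewrite parts_block_cat; congr (_ :: _); lia.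
Qed.

(** Prepending a bit to the first block [0^a 1^b] keeps this form: a [0]
    increments [a], and a [1] not followed by [0] forces [a = 0]. *)
Lemma mem_fillings_parts u : u \in fillings (parts u).
Proof.
elim/parts_ind: u => [//|u IH|b u nc IH].
  rewrite [parts _]/=; case: (parts u) (parts_neq0 u) IH => // g c _ IH.
  by apply/allpairsPdep; exists 0, u.
rewrite parts_cons //.
case: (parts u) (parts_neq0 u) IH => // g [|h c] _; rewrite [incr_nth _ _]/=.
  case/mapP=> a; rewrite mem_iota => a_g eq_u.
  apply/mapP; exists (if b then 0 else a.+1).
    by rewrite mem_iota; case: b {nc}; lia.
  case: b nc => nc /=; last first.
    by rewrite eq_u /=; congr (_ :: _ ++ nseq _ _); lia.
  rewrite eq_u in nc *; case: a a_g nc {eq_u} => //= a_g _.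
  by rewrite !subn0; case: g a_g.
case/allpairsPdep=> a [t] []; rewrite mem_iota => a_g t_c eq_u.
apply/allpairsPdep; exists (if b then 0 else a.+1), t; split => //.
  by rewrite mem_iota; case: b {nc}; lia.
case: b nc => nc /=; last first.
  by rewrite eq_u /=; congr (_ :: _ ++ nseq _ _ ++ _); lia.
rewrite eq_u in nc *; case: a a_g nc {eq_u} => //= a_g _.
by rewrite !subn0; case: g a_g.
Qed.

Lemma mem_fillings c u : (u \in fillings c) = (parts u == c).
Proof.
by apply/idP/eqP => [/parts_fillings|<-]; last exact: mem_fillings_parts.
Qed.

(** The factor [10] after a block begins with [1], so the first [1] ends the
    leading zeros even when the block has no [1] of its own; the choice made in
    the first block can thus be read off the word. *)
Lemma index_true_block a b t :
  index true (nseq a false ++ nseq b true ++ true :: t) = a.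
Proof. by elim: a => [|a /= -> //]; case: b. Qed.

Lemma uniq_fillings c : uniq (fillings c).
Proof.
elim: c => [//|g [|h c] IH].
  rewrite map_inj_in_uniq ?iota_uniq // => a b _ _.
  move/(congr1 (count_mem false)); rewrite !count_cat !count_nseq /=.
  lia.
apply: allpairs_uniq => //; first exact: iota_uniq.
move=> [a t] [b s] _ _ /= eq_ab.
have eq_a : a = b.
  by move/(congr1 (index true)): eq_ab; rewrite !index_true_block.
rewrite -eq_a in eq_ab *; congr (_, _).
by move/eqP: eq_ab; rewrite !eqseq_cat ?eqxx //= => /eqP[].
Qed.

Lemma size_fillings c :
  c != [::] -> size (fillings c) = \prod_(g <- c) g.
Proof.
elim: c => [//|g [|h c] IH] _; first by rewrite big_seq1 size_map size_iota.
by rewrite big_cons -IH // [LHS]size_allpairs size_iota.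
Qed.

(** The length condition on [c] puts every filling into [n.-tuple bool]. *)
Lemma card_parts n c : c != [::] -> sumn c + size c = n.+2 ->
  #|[set u : n.-tuple bool | parts u == c]| = \prod_(g <- c) g.
Proof.
move=> c_n0 sz_c; rewrite -size_fillings // cardE -(size_map val).
apply/perm_size/uniq_perm; rewrite ?uniq_fillings //.
  by rewrite (map_inj_uniq val_inj) enum_uniq.
move=> u; rewrite mem_fillings; apply/mapP/eqP => [[v]|eq_c].
  by rewrite mem_enum inE => /eqP <- ->.
have sz_u : size u == n.
  by apply/eqP; move: (sumn_parts u); rewrite eq_c sz_c => -[].
by exists (Tuple sz_u); rewrite // mem_enum inE /= eq_c.
Qed.

(** * Orientations of a path as bit words *)

Definition orient n (u : seq bool) : {set path_graph n.+1 * path_graph n.+1} :=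
  [set a : 'I_n.+1 * 'I_n.+1 |
    (a.2 == a.1.+1 :> nat) && nth false u a.1 ||
    (a.1 == a.2.+1 :> nat) && ~~ nth false u a.2].

Lemma arc_orient n u (x y : 'I_n.+1) :
  arc (orient n u) x y =
    (y == x.+1 :> nat) && nth false u x ||
    (x == y.+1 :> nat) && ~~ nth false u y.
Proof. by rewrite /arc inE. Qed.

Lemma adj_orient n u (x y : 'I_n.+1) : adj (orient n u) x y = path_edge x y.
Proof.
rewrite /adj !arc_orient /path_edge; move: (nth _ _ x) (nth _ _ y).
by do 2!case; lia.
Qed.

Lemma connect_invariant (T : finType) (e : rel T) (a : pred T) x y :
  (forall y z, e y z -> a y -> a z) -> connect e x y -> a x -> a y.
Proof.
move=> e_a /connectP[s].
elim: s x => [x _ -> //|z s IH x /= /andP[xz zs] eq_y ax].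
exact: IH zs eq_y (e_a _ _ xz ax).
Qed.

(** An edge is the only passage between its two sides and can be crossed in one
    direction only, so a walk starting with it never comes back to its
    origin. *)
Lemma acyclic_orient n u : acyclic (orient n u).
Proof.
apply/forallP => x; apply/forallP => y; apply/implyP => xy; apply/negP => yx.
move: xy; rewrite arc_orient => /orP[] /andP[/eqP eq_xy bx].
  have: [pred z : 'I_n.+1 | x < z] x.
    apply: (connect_invariant _ _ _ _ _ _ yx) => [z t|];
      last by rewrite /= eq_xy.
    rewrite arc_orient /= => /orP[] /andP[/eqP eq_zt bz]; first by lia.
    by have [tx|] := eqVneq (t : nat) x; [rewrite tx bx in bz | lia].
  by rewrite /= ltnn.
have: [pred z : 'I_n.+1 | z < x] x.
  apply: (connect_invariant _ _ _ _ _ _ yx) => [z t|]; last by rewrite /= eq_xy.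
  rewrite arc_orient /= => /orP[] /andP[/eqP eq_zt bz]; last by lia.
  by have [zy|] := eqVneq (z : nat) y; [rewrite -zy bz in bx | lia].
by rewrite /= ltnn.
Qed.

Lemma orient_dag n u : orient n u \in dags (path_graph n.+1).
Proof.
rewrite inE acyclic_orient andbT; apply/forallP => x; apply/forallP => y.
rewrite adj_orient eqxx /= !arc_orient.
case: (eqVneq (y : nat) x.+1) => [eq_y|_] /=.
  have -> : (x == y.+1 :> nat) = false by lia.
  by rewrite orbF andbN.
by case: (eqVneq (x : nat) y.+1) => _ //=; rewrite orbF andNb.
Qed.

Lemma orient_inj n (u v : n.-tuple bool) : orient n u = orient n v -> u = v.
Proof.
move=> eq_uv; apply/val_inj/(@eq_from_nth _ false).
  by rewrite !size_tuple.
rewrite size_tuple => i lt_i.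
have lt_i1 : i < n.+1 by lia.
have := arc_orient n u (Ordinal lt_i1) (Ordinal (lt_i : i.+1 < n.+1)).
rewrite eq_uv arc_orient /= eqxx /=.
have -> : (i == i.+2) = false by lia.
by rewrite !orbF.
Qed.

Lemma dag_orient n D : D \in dags (path_graph n.+1) ->
  exists u : n.-tuple bool, D = orient n u.
Proof.
rewrite inE => /andP[orD _].
have {}orD (x y : 'I_n.+1) :
    path_edge x y = arc D x y || arc D y x /\ ~~ (arc D x y && arc D y x).
  by have /forallP/(_ x)/forallP/(_ y)/andP[/eqP] := orD.
exists [tuple arc D (inord i) (inord i.+1) | i < n].
have nthE (x y : 'I_n.+1) : y = x.+1 :> nat ->
    nth false [tuple arc D (inord i) (inord i.+1) | i < n] x = arc D x y.
  move=> eq_y; have lt_x : x < n by have := ltn_ord y; lia.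
  rewrite -[nat_of_ord x]/(nat_of_ord (Ordinal lt_x)) -tnth_nth tnth_mktuple /=.
  by rewrite -eq_y !inord_val.
apply/setP => -[x y]; rewrite -[LHS]/(arc D x y) -[RHS]/(arc (orient n _) x y).
rewrite arc_orient; have [] := orD x y; rewrite /path_edge.
case: (eqVneq (y : nat) x.+1) => [eq_y _ _|ne_y].
  rewrite (nthE x y) //; have -> : (x == y.+1 :> nat) = false by lia.
  by rewrite orbF.
case: (eqVneq (x : nat) y.+1) => [eq_x|ne_x].
  by rewrite (nthE y x) // orbT /=; do 2!case: (arc D _ _).
by case: (arc D x y).
Qed.

(** The two disjuncts are the two mirror triples recording the immorality at
    [j]. *)
Lemma mem_immoralities_orient n (u : n.-tuple bool) (i j k : 'I_n.+1) :
  ((i, j, k) \in immoralities (orient n u)) =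
    [&& j == i.+1 :> nat, k == j.+1 :> nat & nth false (colliders u) i] ||
    [&& j == k.+1 :> nat, i == j.+1 :> nat & nth false (colliders u) k].
Proof.
rewrite inE adj_orient !arc_orient /path_edge !nth_colliders -val_eqE /=.
have d m : m < n -> nth true u m = nth false u m.
  by move=> lt_m; apply: set_nth_default; rewrite size_tuple.
have [ji|ji] := eqVneq (j : nat) i.+1; have [kj|kj] := eqVneq (k : nat) j.+1.
- rewrite -ji (d j); last by have := ltn_ord k; lia.
  by do !case: (nth _ _ _); lia.
- by do !case: (nth _ _ _); lia.
- by do !case: (nth _ _ _); lia.
have [jk|jk] := eqVneq (j : nat) k.+1; last first.
  by do !case: (nth _ _ _); lia.
have [ij|ij] := eqVneq (i : nat) j.+1; last first.
  by do !case: (nth _ _ _); lia.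
rewrite -jk (d j); last by have := ltn_ord i; lia.
by do !case: (nth _ _ _); lia.
Qed.

(** All orientations share the skeleton, so equivalence compares immoralities,
    that is, positions of the factors [10], that is, block lengths. *)
Lemma markov_equiv_orient n (u v : n.-tuple bool) :
  markov_equiv (orient n u) (orient n v) = (parts u == parts v).
Proof.
rewrite -colliders_parts /markov_equiv.
have -> /= : same_skeleton (orient n u) (orient n v).
  by apply/forallP => x; apply/forallP => y; rewrite !adj_orient.
apply/eqP/eqP => [eq_im|eq_c]; last first.
  by apply/setP => -[[i j] k]; rewrite !mem_immoralities_orient eq_c.
apply: (@eq_from_nth _ false); rewrite !size_colliders !size_tuple // => i lt_i.
case: (ltnP i.+1 n) => [lt_i1|ge_i1]; last first.
  (* The last edge has no successor, so it never starts a factor [10]. *)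
  by rewrite !nth_colliders ![nth true _ _]nth_default ?size_tuple ?andbF.
have lt_in k : k < 3 -> i + k < n.+1 by lia.
have := mem_immoralities_orient n v (Ordinal (lt_in 0 isT))
  (Ordinal (lt_in 1 isT)) (Ordinal (lt_in 2 isT)).
rewrite -eq_im mem_immoralities_orient /= addn0 addn1 addn2 !eqxx /=.
have -> : (i.+1 == i.+3) = false by lia.
by rewrite !orbF.
Qed.

(** * Classes and compositions *)

Lemma size_uniq_card (T : finType) (s : seq T) (A : {set T}) :
  uniq s -> s =i A -> #|A| = size s.
Proof. by move=> /card_uniqP <- eq_sA; apply: eq_card. Qed.

Definition mec n (c : seq nat) : {set {set path_graph n.+1 * path_graph n.+1}} :=
  [set orient n u | u : n.-tuple bool & parts u == c].

Lemma card_mec n c : c != [::] -> sumn c + size c = n.+2 ->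
  #|mec n c| = \prod_(g <- c) g.
Proof.
move=> c_n0 sz_c; rewrite card_imset; last exact: orient_inj.
by rewrite -(card_parts n) //; apply: eq_card => u; rewrite inE.
Qed.

Lemma MECs_path n (C : {set {set path_graph n.+1 * path_graph n.+1}}) :
  reflect (exists u : n.-tuple bool, C = mec n (parts u))
    (C \in MECs (path_graph n.+1)).
Proof.
have class_mec (u : n.-tuple bool) :
    [set D in dags (path_graph n.+1) | markov_equiv (orient n u) D] =
    mec n (parts u).
  apply/setP => D; rewrite inE; apply/andP/imsetP => [[/dag_orient[v ->]]|[v]].
    by rewrite markov_equiv_orient eq_sym => eq_uv; exists v; rewrite ?inE.
  by rewrite inE eq_sym => eq_uv ->; rewrite orient_dag markov_equiv_orient.
apply: (iffP imsetP) => [[_ /dag_orient[u ->] ->]|[u ->]].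
  by exists u; rewrite class_mec.
by exists (orient n u); rewrite ?orient_dag // class_mec.
Qed.

Lemma mec_inj n (u v : n.-tuple bool) :
  mec n (parts u) = mec n (parts v) -> parts u = parts v.
Proof.
move/setP/(_ (orient n u)); rewrite imset_f ?inE ?eqxx //.
by case/esym/imsetP => w; rewrite inE => /eqP <- /orient_inj ->.
Qed.

Definition part_seqs n : seq (seq nat) :=
  undup [seq parts u | u : n.-tuple bool].

(** A list of positive numbers with the right length condition is attained,
    because the number of its fillings is a product of positive numbers. *)
Lemma mem_part_seqs n c :
  (c \in part_seqs n) = all (leq 1) c && (sumn c + size c == n.+2).
Proof.
rewrite mem_undup; apply/mapP/andP => [[u _ ->]|[c_gt0 /eqP sz_c]].
  by rewrite parts_gt0 sumn_parts size_tuple.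
have c_n0 : c != [::] by case: c sz_c {c_gt0}.
have : 0 < #|[set u : n.-tuple bool | parts u == c]|.
  rewrite card_parts // big_seq; apply: prodn_cond_gt0 => g.
  exact: (allP c_gt0).
by case/card_gt0P => u; rewrite inE => /eqP <-; exists u; rewrite ?mem_enum.
Qed.

(** [mec n] is a bijection from the part lists of words of length [n] onto the
    classes, and turns products into cardinals. *)
Lemma num_MECs_path l n :
  num_MECs l (path_graph n.+1) =
  count (fun c => l == \prod_(g <- c) g) (part_seqs n).
Proof.
rewrite -size_filter -(size_map (mec n)).
have partsP c : c \in part_seqs n -> exists u : n.-tuple bool, c = parts u.
  by rewrite mem_undup => /mapP[u _ ->]; exists u.
have card_parts_mec (u : n.-tuple bool) :
    #|mec n (parts u)| = \prod_(g <- parts u) g.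
  by rewrite card_mec ?parts_neq0 // sumn_parts size_tuple.
apply: size_uniq_card.
  rewrite map_inj_in_uniq ?filter_uniq ?undup_uniq // => c d.
  rewrite !mem_filter => /andP[_ /partsP[u ->]] /andP[_ /partsP[v ->]].
  exact: mec_inj.
move=> C; rewrite inE; apply/mapP/andP => [[c]|[/MECs_path[u ->]]].
  rewrite mem_filter => /andP[/eqP -> /partsP[u ->]] ->.
  by split; [apply/MECs_path; exists u | rewrite card_parts_mec].
rewrite card_parts_mec => /eqP eq_l; exists (parts u) => //.
rewrite mem_filter eq_l eqxx mem_undup; apply/mapP; exists u => //.
by rewrite mem_enum.
Qed.

(** For lists of size [k.+1], the condition [sumn c + size c = n.+2] defining
    part lists says that [c] is a composition of [n.+1 - k]. *)
Lemma card_compositions (l n k : nat) : k <= n ->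
  #|[set c in compositions (n.+1 - k) k.+1 | l == \prod_(i < k.+1) tnth c i]| =
  count (fun c => (l == \prod_(g <- c) g) && (size c == k.+1)) (part_seqs n).
Proof.
move=> le_kn; set S := finset _.
pose vals (c : k.+1.-tuple 'I_(n.+1 - k).+1) := [seq val i | i <- c].
have vals_inj : injective vals by move=> c d /(inj_map val_inj) /val_inj.
rewrite -size_filter cardE -(size_map vals); apply/perm_size/uniq_perm.
- by rewrite map_inj_uniq ?enum_uniq.
- by rewrite filter_uniq ?undup_uniq.
have sumE (c : k.+1.-tuple 'I_(n.+1 - k).+1) :
    \sum_(i < k.+1) tnth c i = sumn (vals c).
  by rewrite sumnE big_map big_tuple.
have prodE (c : k.+1.-tuple 'I_(n.+1 - k).+1) :
    \prod_(i < k.+1) tnth c i = \prod_(g <- vals c) g.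
  by rewrite big_map big_tuple.
have posE (c : k.+1.-tuple 'I_(n.+1 - k).+1) :
    [forall i : 'I_k.+1, 0 < tnth c i] = all (leq 1) (vals c).
  by rewrite all_map; apply/forallP/all_tnthP.
have memS c : (c \in S) =
    [&& all (leq 1) (vals c), sumn (vals c) == n.+1 - k
      & l == \prod_(g <- vals c) g].
  by rewrite !inE posE sumE prodE andbA.
move=> c; rewrite mem_filter mem_part_seqs.
apply/mapP/andP => [[d]|[/andP[l_c /eqP sz_c] /andP[c_gt0 /eqP sum_c]]].
  rewrite mem_enum memS => /and3P[d_gt0 /eqP sum_d l_d] ->.
  rewrite l_d d_gt0 size_map size_tuple eqxx /=; split => //.
  by apply/eqP; rewrite sum_d; lia.
have {}sum_c : sumn c = n.+1 - k by rewrite sz_c in sum_c; lia.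
have sz_d : size [seq inord g : 'I_(n.+1 - k).+1 | g <- c] == k.+1.
  by rewrite size_map sz_c.
have vals_d : vals (Tuple sz_d) = c.
  rewrite /vals /= -map_comp -[RHS]map_id; apply/eq_in_map => g g_c /=.
  by rewrite inordK // ltnS -sum_c sumnE (big_rem g) //= leq_addr.
by exists (Tuple sz_d); rewrite // mem_enum memS vals_d c_gt0 sum_c eqxx.
Qed.

Theorem theorem2p2 (p l : nat) (hp : 1 <= p) (hl : 1 <= l) :
  num_MECs l (path_graph p) =
  \sum_(k < (p %/ 2).+1)
    #|[set c in compositions (p - k) k.+1 | l == \prod_(i < k.+1) tnth c i]|.
Proof.
case: p hp => // n _; rewrite num_MECs_path -sum1_count.
have size_part c : c \in part_seqs n -> 0 < size c <= (n.+1 %/ 2).+1.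
  rewrite mem_part_seqs => /andP[c_gt0 /eqP sz_c].
  (* Parts are positive, so [2 * size c <= n.+2]. *)
  have : size c <= sumn c.
    by elim: c c_gt0 {sz_c} => //= g c IH /andP[g_gt0 /IH]; lia.
  by case: c sz_c {c_gt0} => //= g c; lia.
rewrite big_seq_cond.
rewrite (partition_big
  (fun c => inord (size c).-1 : 'I_(n.+1 %/ 2).+1) xpredT) //=.
apply: eq_bigr => k _.
case: (leqP k n) => [le_kn|]; last by have := ltn_ord k; lia.
rewrite card_compositions // -sum1_count [RHS]big_seq_cond.
apply: eq_bigl => c; rewrite -andbA; case c_n: (c \in _) => //=; congr andb.
have := size_part c c_n => /andP[sz_gt0 sz_le].
by case: (size c) sz_gt0 sz_le => // m _ le_m; rewrite -val_eqE /= inordK.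
Qed.
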